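(* Let $\alpha,\beta,\lambda\in(0,1)$ with $\kappa:=\alpha+\beta+\lambda<1$, and for a function $f$ on $(0,\infty)$ let $$U_{\alpha,\beta,\lambda}[f](x)=x^{-\beta}\int_0^x \frac{y^{-\alpha} f(y)\,dy}{|x-y|^{\lambda}},\qquad x\in(0,\infty).$$ Let $p_-=\frac{1}{1-\alpha}$, $p_+=\frac{1}{1-\alpha-\lambda}$, and for $p\in(p_-,p_+]$ let $q=q(p)$ be defined by $1+\frac1q=\frac1p+\kappa$. Define $$K(\alpha,\beta,\lambda;p)=\sup_{f\in L_p(\mathbb{R}_+),\,f\neq0}\frac{|U_{\alpha,\beta,\lambda}[f]|_{q(p)}}{|f|_p}.$$ Then there exist constants $C_3(\alpha,\beta,\lambda),C_4(\alpha,\beta,\lambda)\in(0,\infty)$ such that for all $p\in(p_-,p_+]$, $$\frac{C_3(\alpha,\beta,\lambda)}{(p-p_-)^{\kappa}}\le K(\alpha,\beta,\lambda;p)\le \frac{C_4(\alpha,\beta,\lambda)}{(p-p_-)^{\kappa}}.$$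
   Context: For a measurable function $g$ on $\mathbb{R}_+=(0,\infty)$, $|g|_p=\left(\int_0^\infty |g(x)|^p\,dx\right)^{1/p}$ denotes the usual Lebesgue $L_p$ norm, and $L_p(\mathbb{R}_+)$ is the space of functions with $|g|_p<\infty$. *)

(* Defs.v *)
From HB Require Import structures.
From mathcomp Require Import all_boot all_order all_algebra.
From mathcomp Require Import all_classical all_reals all_analysis.
Set Implicit Arguments. Unset Strict Implicit. Unset Printing Implicit Defensive.
Import Order.TTheory GRing.Theory Num.Theory.
Local Open Scope classical_set_scope.
Local Open Scope ring_scope.

Section Defs.
Variable R : realType.

Definition Rpos : set R := `]0, +oo[%classic.

Definition normLp (p : R) (g : R -> R) : \bar R :=
  poweR (\int[@lebesgue_measure R]_(x in Rpos) (`|g x| `^ p)%:E) p^-1.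

Definition inLp (p : R) (f : R -> R) : Prop :=
  measurable_fun Rpos f /\ (normLp p f < +oo)%E.

(* U[f](x) = x^{-beta} int_0^x y^{-alpha} f(y) |x-y|^{-lambda} dy.
   The inner Lebesgue integral is taken in \bar R and converted with [fine]
   (it is finite for a.e. x when f is in L_p, p > p_-). *)
Definition Uop (a b l : R) (f : R -> R) (x : R) : R :=
  x `^ (- b) *
  fine (\int[@lebesgue_measure R]_(y in `]0, x[%classic)
          (y `^ (- a) * f y * `|x - y| `^ (- l))%:E).

Definition pminus (a : R) : R := (1 - a)^-1.
Definition pplus (a l : R) : R := (1 - a - l)^-1.
Definition qexp (a b l p : R) : R := (p^-1 + (a + b + l) - 1)^-1.

Definition Kconst (a b l p : R) : \bar R :=
  ereal_sup [set (normLp (qexp a b l p) (Uop a b l f) * ((fine (normLp p f))^-1)%:E)%E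
            | f in [set f | inLp p f /\ normLp p f != 0%E]].

End Defs.

(* Main.v *)
(* With [e = 1 - a - 1/p] (comparable to [p - p_-]) and [k = a + b + l] one has
   [1/q = b + l - e].  Upper bound: after the substitution
   [f(y) = y^(-1/p) F(y)], [U f(x) = x^(-1/q) G(x)], the operator becomes the
   convolution on the multiplicative group of [F] with
   [h(t) = t^(-e) (1 - 1/t)^(-l)], [t > 1], and [1 + 1/q = 1/p + k].  Young's
   inequality then bounds the norm by the [L^(1/k)(dt/t)] norm of [h], whose
   [1/k]-th power is [O(1/e)].  It is carried out in the original
   variables, by a three-term Hoelder inequality and Tonelli's theorem.
   Lower bound: on [x > 1], [U] dominates the Hardy operator
   [x^(-b-l) int_0^x y^(-a) f(y) dy], which is tested on the power
   [f(y)^p = y^(-a p')] on [(0, 1)]; its quotient there is exactly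
   [(1/p')^(1/p') (1/q)^(1/q) e^(-k)]. *)

Require Import Defs.
From HB Require Import structures.
From mathcomp Require Import all_boot all_order all_algebra.
From mathcomp Require Import all_classical all_reals all_analysis.
From mathcomp Require Import measurable_realfun.
From mathcomp Require Import ring lra.
Import Order.TTheory GRing.Theory Num.Theory.
Import numFieldNormedType.Exports.
Local Open Scope ring_scope.
Local Open Scope classical_set_scope.

(** * Integrals of powers *)

(** The integral of a nonnegative function is a supremum over the simple functions below it, and a
    larger function has more of them. This allows comparisons with integrals of powers of [Uop],
    whose measurability is never established. *)
Lemma ge0_le_integral_nomeas d (T : measurableType d) {R : realType}
    (mu : {measure set T -> \bar R}) (D : set T) (f g : T -> \bar R) :
  (forall x, D x -> (0 <= f x)%E) -> (forall x, D x -> (f x <= g x)%E) ->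
  (\int[mu]_(x in D) f x <= \int[mu]_(x in D) g x)%E.
Proof.
move=> f0 fg; have g0 x : D x -> (0 <= g x)%E.
  by move=> Dx; apply: le_trans (f0 _ Dx) (fg _ Dx).
rewrite !ge0_integralE//; apply: le_ereal_sup => _ [h hf <-]; exists h => //= x.
apply: le_trans (hf x) _; exact: lee_restrict.
Qed.

(** The fundamental theorem holds on each compact interval of the exhaustion, and monotone
    convergence passes to [D]. Thus [f] may blow up at the ends of [D], and [D] may be unbounded. *)
Lemma ge0_exhaustion_FTC2 {R : realType} (D : set R) (f F : R -> R)
    (a_ b_ : R^nat) :
  open D -> (forall n, a_ n < b_ n) ->
  nonincreasing_seq a_ -> nondecreasing_seq b_ ->
  D = \bigcup_n `[a_ n, b_ n] ->
  (forall x, D x -> 0 <= f x) -> {in D, continuous f} ->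
  (forall x, D x -> is_derive x 1 F (f x)) ->
  ((F (b_ n) - F (a_ n))%:E @[n --> \oo] -->
    \int[@lebesgue_measure R]_(x in D) (f x)%:E)%E.
Proof.
move=> oD ab ai bd DE f0 cf dF.
have subD n : `[a_ n, b_ n] `<=` D by move=> x xn; rewrite DE; exists n.
have inD n x : x \in `[a_ n, b_ n]%R -> D x by move=> xn; apply: (subD n).
have cF x : D x -> {for x, continuous F}.
  move=> /dF [dFx _]; apply: differentiable_continuous.
  exact/derivable1_diffP.
have mf : measurable_fun D f.
  by exact: open_continuous_measurable_fun.
have -> : (fun n => (F (b_ n) - F (a_ n))%:E) =
    (fun n => \int[@lebesgue_measure R]_(x in `[a_ n, b_ n]) (f x)%:E)%E.
  apply/funext => n; rewrite (@continuous_FTC2 _ f F) //.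
  - by apply: continuous_in_subspaceT => x /set_mem/subD/mem_set; exact: cf.
  - split.
    + move=> x xn; have /dF[] // : D x.
      by apply: (inD n); exact: subset_itv_oo_cc.
    + by apply: cvg_at_right_filter; apply: cF; apply: (inD n);
        rewrite in_itv/= lexx ltW.
    + by apply: cvg_at_left_filter; apply: cF; apply: (inD n);
        rewrite in_itv/= lexx ltW.
  - move=> x xn; have Dx : D x.
      by apply: (inD n); exact: subset_itv_oo_cc.
    by rewrite derive1E; have [_ ->] := dF _ Dx.
rewrite DE; apply: ge0_nondecreasing_set_cvg_integral.
- move=> m n mn; apply/subsetPset => x /=; rewrite !in_itv/= => /andP[h1 h2].
  by rewrite (le_trans (ai _ _ mn) h1) (le_trans h2 (bd _ _ mn)).
- by move=> i; exact: measurable_itv.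
- move=> i; apply/measurable_EFinP; apply: measurable_funS mf => //;
    exact: open_measurable.
- by move=> i x /subD/f0; rewrite lee_fin.
Qed.

Lemma continuous_powR {R : realType} (a x : R) :
  0 < x -> {for x, continuous (fun t : R => t `^ a)}.
Proof.
move=> x0; apply: differentiable_continuous; apply/derivable1_diffP.
by apply: derivable_powR; rewrite in_itv/= andbT.
Qed.

Lemma cvg_powR {R : realType} (a x : R) (u : R^nat) :
  0 < x -> u n @[n --> \oo] --> x -> u n `^ a @[n --> \oo] --> x `^ a.
Proof. by move=> /(continuous_powR a) ca ux;
  exact: (continuous_cvg _ ca ux). Qed.

Lemma cvg_powR0 {R : realType} (a : R) (u : R^nat) :
  0 < a -> (forall n, 0 < u n) -> u n @[n --> \oo] --> 0 ->
  u n `^ a @[n --> \oo] --> 0.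
Proof.
by move=> a0 u0 uc; exact: ((cvg_at_rightP _ _ _).1 (powR_cvg0 a0)).
Qed.

Lemma is_derive_powR_rev {R : realType} (a x y : R) : y < x ->
  is_derive y 1 (fun t : R => (x - t) `^ a) (- (a * (x - y) `^ (a - 1))).
Proof.
move=> yx; have xy : 0 < x - y by rewrite subr_gt0.
have d1 := is_derive1_powR a xy.
have d2 : is_derive y 1 (fun t : R => x - t) (-1).
  have -> : (-1 : R) = 0 - 1 by rewrite sub0r.
  exact: is_deriveB.
have := @is_derive1_comp _ (fun u : R => u `^ a) (fun t : R => x - t) _ _ _ d1 d2.
by rewrite mulrN1.
Qed.

Lemma is_derive_powR_shift {R : realType} (a x y : R) : y < x ->
  is_derive x 1 (fun t : R => (t - y) `^ a) (a * (x - y) `^ (a - 1)).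
Proof.
move=> yx; have xy : 0 < x - y by rewrite subr_gt0.
have d1 := is_derive1_powR a xy.
have d2 : is_derive x 1 (fun t : R => t - y) 1.
  have := @is_deriveB _ _ _ id (cst y) x 1 1 0 (is_derive_id _ _) (is_derive_cst _ _ _).
  by rewrite subr0.
have := @is_derive1_comp _ (fun u : R => u `^ a) (fun t : R => t - y) _ _ _ d1 d2.
by rewrite mulr1.
Qed.

(** The shift by two makes every term smaller than 1/2, so [x * harmonic n.+2] lies strictly below
    [x - x * harmonic n.+2] already for [n = 0]; a shift by one would give equality there. *)
Lemma cvg_harmonic2 {R : realType} : @harmonic R n.+2 @[n --> \oo] --> 0.
Proof.
have : @harmonic R @ \oo --> 0 := cvg_harmonic.
by rewrite -(cvg_shiftn 2) /=; under eq_fun do rewrite addn2.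
Qed.

Lemma harmonic2_lt {R : realType} n : @harmonic R n.+2 < 2^-1.
Proof. by rewrite ltf_pV2 ?posrE// ltr_nat. Qed.

Lemma nonincreasing_harmonic2 {R : realType} (m n : nat) :
  (m <= n)%N -> @harmonic R n.+2 <= harmonic m.+2.
Proof. by move=> mn; rewrite lef_pV2 ?posrE// ler_nat !ltnS. Qed.

Lemma itv_oo_bigcup_harmonic {R : realType} (x : R) : 0 < x ->
  `]0, x[%classic =
  \bigcup_n `[x * harmonic n.+2, x - x * harmonic n.+2]%classic.
Proof.
move=> x0; apply/seteqP; split => y /=.
  rewrite in_itv/= => /andP[y0 yx].
  have d0 : 0 < Num.min y (x - y) by rewrite lt_min y0 subr_gt0.
  have xh : x * harmonic n.+2 @[n --> \oo] --> x * 0.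
    by apply: cvgM; [exact: cvg_cst|exact: cvg_harmonic2].
  have xd : x * 0 < Num.min y (x - y) by rewrite mulr0.
  have [N _ /(_ N (leqnn N))/=] := cvgr_lt _ xh _ xd.
  rewrite lt_min => /andP[h1 h2]; exists N => //=.
  by rewrite in_itv/= (ltW h1)/= lerBrDr -lerBrDl ltW.
move=> [n _] /=; rewrite !in_itv/= => /andP[h1 h2].
have xh : 0 < x * @harmonic R n.+2 by rewrite mulr_gt0// harmonic_gt0.
by rewrite (lt_le_trans xh h1)/= (le_lt_trans h2)// ltrBlDr ltrDl.
Qed.

Lemma ge0_integral_oo_FTC2 {R : realType} (f F : R -> R) (x l : R) :
  0 < x ->
  (forall y, 0 < y < x -> 0 <= f y) ->
  (forall y, 0 < y < x -> {for y, continuous f}) ->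
  (forall y, 0 < y < x -> is_derive y 1 F (f y)) ->
  F (x - x * harmonic n.+2) - F (x * harmonic n.+2) @[n --> \oo] --> l ->
  (\int[@lebesgue_measure R]_(y in `]0%R, x[) (f y)%:E = l%:E)%E.
Proof.
move=> x0 f0 cf dF Fl.
have h0 n : 0 < x * @harmonic R n.+2 by rewrite mulr_gt0// harmonic_gt0.
have dF' y : `]0, x[%classic y -> is_derive y 1 F (f y).
  by rewrite /= in_itv/=; exact: dF.
have := @ge0_exhaustion_FTC2 _ `]0, x[%classic f F
    (fun n => x * harmonic n.+2) (fun n => x - x * harmonic n.+2).
move=> /(_ _ _ _ _ _ _ _ dF')/cvg_unique-/(_ (@ereal_hausdorff R) _); apply.
- exact: interval_open.
- move=> n; rewrite ltrBrDr -mulrDr -[ltRHS]mulr1 ltr_pM2l//.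
  by rewrite [ltRHS]splitr mul1r ltrD ?harmonic2_lt.
- by move=> m n mn; rewrite ler_wpM2l ?(ltW x0)//;
    exact: nonincreasing_harmonic2.
- move=> m n mn; rewrite lerB// ler_wpM2l ?(ltW x0)//.
  exact: nonincreasing_harmonic2.
- exact: itv_oo_bigcup_harmonic.
- by move=> y /=; rewrite in_itv/=; exact: f0.
- by move=> y; rewrite inE/= in_itv/=; exact: cf.
- by apply: cvg_EFin => //; exact: nearW.
Qed.

Lemma cvg_powR_harmonic_diff {R : realType} (s x : R) : 0 < s -> 0 < x ->
  (x - x * harmonic n.+2) `^ s - (x * harmonic n.+2) `^ s @[n --> \oo]
    --> x `^ s.
Proof.
move=> s0 x0.
have xh : x * harmonic n.+2 @[n --> \oo] --> 0.
  rewrite -[X in _ --> X](mulr0 x).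
  by apply: cvgM; [exact: cvg_cst|exact: cvg_harmonic2].
rewrite -[X in _ --> X]subr0; apply: cvgB.
  apply: cvg_powR => //; rewrite -[X in _ --> X]subr0.
  by apply: cvgB => //; exact: cvg_cst.
by apply: cvg_powR0 => // n; rewrite mulr_gt0// harmonic_gt0.
Qed.

Lemma integral_powR0 {R : realType} (s x : R) : 0 < s -> 0 < x ->
  (\int[@lebesgue_measure R]_(y in `]0%R, x[) (y `^ (s - 1))%:E =
   (x `^ s / s)%:E)%E.
Proof.
move=> s0 x0.
apply: (ge0_integral_oo_FTC2 (fun y => y `^ (s - 1)) (fun y => s^-1 * y `^ s)) => //.
- by move=> y _; exact: powR_ge0.
- by move=> y /andP[y0 _]; exact: continuous_powR.
- move=> y /andP[y0 _].
  have := @is_deriveZ _ _ _ _ s^-1 y 1 _ (is_derive1_powR s y0).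
  by rewrite scalerA mulVf ?gt_eqF// scale1r.
- under eq_fun do rewrite -mulrBr.
  rewrite mulrC; apply: cvgM; first exact: cvg_cst.
  exact: cvg_powR_harmonic_diff.
Qed.

Lemma integral_powR_rev {R : realType} (s x : R) : 0 < s -> 0 < x ->
  (\int[@lebesgue_measure R]_(y in `]0%R, x[) ((x - y) `^ (s - 1))%:E =
   (x `^ s / s)%:E)%E.
Proof.
move=> s0 x0.
apply: (ge0_integral_oo_FTC2 (fun y => (x - y) `^ (s - 1))
  (fun y => - s^-1 * (x - y) `^ s)) => //.
- by move=> y _; exact: powR_ge0.
- move=> y /andP[_ yx].
  apply: differentiable_continuous; apply/derivable1_diffP.
  by have [] := is_derive_powR_rev (s - 1) x y yx.
- move=> y /andP[_ yx].
  have := @is_deriveZ _ _ _ _ (- s^-1) y 1 _ (is_derive_powR_rev s x y yx).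
  by rewrite scalerN scaleNr opprK scalerA mulVf ?gt_eqF// scale1r.
- have -> : (fun n => - s^-1 * (x - (x - x * harmonic n.+2)) `^ s -
      - s^-1 * (x - x * harmonic n.+2) `^ s) =
     (fun n => s^-1 * ((x - x * harmonic n.+2) `^ s - (x * harmonic n.+2) `^ s)).
    by apply/funext => n; rewrite subKr; ring.
  rewrite mulrC; apply: cvgM; first exact: cvg_cst.
  exact: cvg_powR_harmonic_diff.
Qed.

Lemma itv_oy_bigcup_harmonic {R : realType} (y : R) :
  `]y, +oo[%classic = \bigcup_n `[y + harmonic n, y + n.+2%:R]%classic.
Proof.
apply/seteqP; split => x /=.
  rewrite in_itv/= andbT => yx.
  have d0 : 0 < x - y by rewrite subr_gt0.
  have [N _ hN] := cvgr_lt _ (cvg_harmonic (R := R)) _ d0.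
  pose M := maxn N (Num.bound (x - y)).
  exists M => //=; rewrite in_itv/= -lerBrDl ltW/=; last first.
    by apply: hN; exact: leq_maxl.
  rewrite -lerBlDl ltW// (lt_le_trans (archi_boundP (ltW d0)))// ler_nat.
  by rewrite !leqW// leq_maxr.
move=> [n _] /=; rewrite !in_itv/= andbT => /andP[h1 _].
by rewrite (lt_le_trans _ h1)// ltrDl harmonic_gt0.
Qed.

(** The conclusion is a convergence rather than a value, so that it also serves
    [integral_powR_shifty_le], where only a bound on the increments of [F] is used. *)
Lemma ge0_integral_oy_FTC2 {R : realType} (f F : R -> R) (y : R) :
  (forall x, y < x -> 0 <= f x) ->
  (forall x, y < x -> {for x, continuous f}) ->
  (forall x, y < x -> is_derive x 1 F (f x)) ->
  ((F (y + n.+2%:R) - F (y + harmonic n))%:E @[n --> \oo] -->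
  \int[@lebesgue_measure R]_(x in `]y, +oo[) (f x)%:E)%E.
Proof.
move=> f0 cf dF.
apply: (@ge0_exhaustion_FTC2 _ `]y, +oo[%classic f F
    (fun n => y + harmonic n) (fun n => y + n.+2%:R)).
- exact: interval_open.
- move=> n; rewrite ltrD2l (@le_lt_trans _ _ 1)//.
    by rewrite invf_le1// ler1n.
  by rewrite ltr1n.
- by move=> m n mn; rewrite lerD2l lef_pV2 ?posrE// ler_nat !ltnS.
- by move=> m n mn; rewrite lerD2l ler_nat !ltnS.
- exact: itv_oy_bigcup_harmonic.
- by move=> x /=; rewrite in_itv/= andbT; exact: f0.
- by move=> x; rewrite inE/= in_itv/= andbT; exact: cf.
- by move=> x /=; rewrite in_itv/= andbT; exact: dF.
Qed.

Lemma integral_powRy {R : realType} (s y : R) : 0 < s -> 0 < y ->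
  (\int[@lebesgue_measure R]_(x in `]y, +oo[) (x `^ (- s - 1))%:E =
   (y `^ (- s) / s)%:E)%E.
Proof.
move=> s0 y0.
have := @ge0_integral_oy_FTC2 R (fun x => x `^ (- s - 1))
  (fun x => - s^-1 * x `^ (- s)) y.
move=> /(_ _ _ _)/cvg_unique-/(_ (@ereal_hausdorff R) _); apply.
- by move=> x _; exact: powR_ge0.
- by move=> x yx; apply: continuous_powR; exact: lt_trans yx.
- move=> x yx.
  have := @is_deriveZ _ _ _ _ (- s^-1) x 1 _
    (is_derive1_powR (- s) (lt_trans y0 yx)).
  by rewrite -![_ *: (_ * _)]/(_ * _) mulrA mulrNN mulVf ?gt_eqF// mul1r.
- apply: cvg_EFin; first exact: nearW.
  rewrite [X in X @ _ --> _](_ : _ = (fun n => - s^-1 * (y + n.+2%:R) `^ (- s) -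
           - s^-1 * (y + harmonic n) `^ (- s)))//.
  rewrite (_ : y `^ (- s) / s = - s^-1 * 0 - - s^-1 * y `^ (- s)); last by ring.
  apply: cvgB; (apply: cvgM; first exact: cvg_cst).
    (* [cvg_powR0] asks for a positive exponent and a sequence tending to 0, hence the passage to
       inverses. *)
    have -> : (fun n => (y + n.+2%:R) `^ (- s)) =
              (fun n => (y + n.+2%:R)^-1 `^ s).
      apply/funext => n; rewrite powRN -[in RHS]powR_inv1; last first.
        by rewrite addr_ge0 ?ler0n// ltW.
      by rewrite -powRrM mulN1r powRN.
    apply: cvg_powR0 => // [n|]; first by rewrite invr_gt0 addr_gt0.
    apply: (@squeeze_cvgr _ _ _ _ (fun=> 0) (@harmonic R)).
    + apply: nearW => n; have yn : 0 < y + n.+2%:R by rewrite addr_gt0.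
      rewrite invr_ge0 (ltW yn) /harmonic/= lef_pV2 ?posrE//.
      by rewrite -[leLHS]add0r lerD ?(ltW y0)// ler_nat.
    + exact: cvg_cst.
    + exact: cvg_harmonic.
  apply: cvg_powR => //; rewrite -[X in _ --> X]addr0.
  by apply: cvgD; [exact: cvg_cst|exact: cvg_harmonic].
Qed.

(** An antiderivative of the integrand is [r^-1] times the [r]-th power of 1 - y/x. It takes values
    in [0, 1/r], so no increment of it exceeds 1/r. *)
Lemma integral_powR_shifty_le {R : realType} (r y : R) : 0 < r -> 0 < y ->
  (\int[@lebesgue_measure R]_(x in `]y, +oo[)
    (y * x `^ (- r - 1) * (x - y) `^ (r - 1))%:E <= (r^-1)%:E)%E.
Proof.
move=> r0 y0.
pose f x := y * x `^ (- r - 1) * (x - y) `^ (r - 1).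
pose F x := r^-1 * ((x - y) `^ r * x `^ (- r)).
have dp (a x : R) : y < x -> derivable (fun t => t `^ a) x 1.
  move=> yx; apply: derivable_powR.
  by rewrite in_itv/= andbT (lt_trans y0).
have dm (a x : R) : y < x -> derivable (fun t => (t - y) `^ a) x 1.
  by move=> yx; have [] := is_derive_powR_shift a x y yx.
have F01 x : y < x -> 0 <= F x <= r^-1.
  move=> yx; have x0 := lt_trans y0 yx.
  rewrite /F mulr_ge0 ?invr_ge0 ?(ltW r0)// ?mulr_ge0 ?powR_ge0//=.
  rewrite ler_piMr ?invr_ge0 ?(ltW r0)// powRN ler_pdivrMr ?powR_gt0// mul1r.
  by rewrite ge0_ler_powR ?nnegrE ?ltW ?subr_gt0// gtrBl.
suff H : ((F (y + n.+2%:R) - F (y + harmonic n))%:E @[n --> \oo] -->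
    \int[@lebesgue_measure R]_(x in `]y, +oo[) (f x)%:E)%E.
  rewrite -(cvg_lim _ H)//; apply: lime_le; first exact: cvgP H.
  apply: nearW => n; rewrite lee_fin lerBlDr.
  have /andP[_ h1] : 0 <= F (y + n.+2%:R) <= r^-1 by apply: F01; rewrite ltrDl.
  have /andP[h2 _] : 0 <= F (y + harmonic n) <= r^-1.
    by apply: F01; rewrite ltrDl harmonic_gt0.
  by rewrite (le_trans h1)// lerDl.
apply: ge0_integral_oy_FTC2.
- by move=> x _; rewrite /f !mulr_ge0 ?powR_ge0 ?(ltW y0).
- move=> x yx; rewrite /f; apply: differentiable_continuous.
  apply/derivable1_diffP; apply: derivableM; last exact: dm.
  by apply: derivableM => //; exact: dp.
- move=> x yx; have x0 := lt_trans y0 yx.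
  have := @is_deriveZ _ _ _ _ r^-1 x 1 _ (is_deriveM
   (is_derive_powR_shift r x y yx) (is_derive1_powR (- r) x0)).
  move/is_derive_eq; apply.
  rewrite -![_ *: _]/(_ * _) /=.
  have xy0 : 0 < x - y by rewrite subr_gt0.
  (* With one factor x - y and one factor x split off, the two terms of the product rule share a
     common factor, and x - (x - y) = y remains. *)
  have -> : (x - y) `^ r = (x - y) * (x - y) `^ (r - 1).
    by rewrite mulr_powRB1// ltW.
  have -> : x `^ (- r) = x * x `^ (- r - 1).
    rewrite -[X in X * _](powRr1 (ltW x0)) -powRD ?(gt_eqF x0) ?implybT//.
    by congr (_ `^ _); ring.
  rewrite /f; field.
  by rewrite gt_eqF.
Qed.

(** * Pointwise bounds for powers *)

Lemma powRD_gt0 {R : realType} (x a b : R) : 0 < x ->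
  x `^ (a + b) = x `^ a * x `^ b.
Proof. by move=> x0; rewrite powRD// (gt_eqF x0) implybT. Qed.

(** Write the power as z^t times 1/z: the first factor is at most x^t, the second at most 2/x. The
    constant 2 comes from the inverse alone and is uniform in [t], which matters when the exponent
    [e / k] tends to 0. *)
Lemma powR_half_le {R : realType} (t x z : R) : 0 < t -> 0 < x ->
  x / 2 <= z <= x -> z `^ (t - 1) <= 2 * x `^ (t - 1).
Proof.
move=> t0 x0 /andP[xz zx].
have z0 : 0 < z by rewrite (lt_le_trans _ xz)// divr_gt0.
rewrite !powRD_gt0// !powR_inv1 ?(ltW x0) ?(ltW z0)// mulrCA.
apply: ler_pM; rewrite ?powR_ge0 ?invr_ge0 ?(ltW z0)//.
  by rewrite ge0_ler_powR ?nnegrE ?(ltW t0) ?(ltW z0) ?(ltW x0).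
by rewrite -invf_div lef_pV2 ?posrE ?divr_gt0.
Qed.

(** One of y and x - y is at least x/2, and its power is then comparable to that of x. This
    decouples the singularities at y = 0 and y = x of a Beta integrand. *)
Lemma powR_mul_split_le {R : realType} (s r x y : R) :
  0 < s -> 0 < r -> 0 < y < x ->
  y `^ (s - 1) * (x - y) `^ (r - 1) <=
  2 * (x `^ (r - 1) * y `^ (s - 1) + x `^ (s - 1) * (x - y) `^ (r - 1)).
Proof.
move=> s0 r0 /andP[y0 yx]; have x0 := lt_trans y0 yx.
rewrite mulrDr; have [h|h] := leP (x / 2) y.
  rewrite -[leLHS]add0r lerD//.
    by rewrite mulr_ge0// mulr_ge0// powR_ge0.
  rewrite mulrA ler_wpM2r ?powR_ge0//; apply: powR_half_le => //.
  by rewrite h ltW.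
rewrite -[leLHS]addr0 lerD//; last first.
  by rewrite mulr_ge0// mulr_ge0// powR_ge0.
rewrite [leLHS]mulrC mulrA ler_wpM2r ?powR_ge0//; apply: powR_half_le => //.
by apply/andP; split; lra.
Qed.

Lemma measurable_fun_powR {R : realType} d (T : measurableType d) (D : set T)
    (f : T -> R) (a : R) :
  measurable_fun D f -> measurable_fun D (fun x => f x `^ a).
Proof. by move=> mf; exact: (measurableT_comp (measurable_powR a)). Qed.

(** * The kernel *)

(* This is [(y/x)^s (1 - y/x)^(r-1)]; for [s = e/k] and [r = 1 - l/k] it is
   [h(x/y)^(1/k)]. *)
Definition hkern {R : realType} (s r x y : R) : R :=
  y `^ s * x `^ (1 - r - s) * (x - y) `^ (r - 1).

Lemma hkern_ge0 {R : realType} (s r x y : R) : 0 <= hkern s r x y.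
Proof. by rewrite !mulr_ge0 ?powR_ge0. Qed.

(** This is [powR_mul_split_le] multiplied by x^(1-r-s) y. Each term on the right carries one
    singularity only and has an elementary integral against dy/y and dx/x. *)
Lemma hkern_le {R : realType} (s r x y : R) : 0 < s -> 0 < r -> 0 < y < x ->
  hkern s r x y <= 2 * (x `^ (- s) * y `^ s) +
    2 * (x `^ (- r) * y * (x - y) `^ (r - 1)).
Proof.
move=> s0 r0 /[dup] yx /andP[y0 yx']; have x0 := lt_trans y0 yx'.
rewrite /hkern.
have -> : y `^ s = y `^ (s - 1) * y.
  by rewrite mulrC mulr_powRB1// ltW.
rewrite -mulrDr.
have <- : (x `^ (r - 1) * y `^ (s - 1) + x `^ (s - 1) * (x - y) `^ (r - 1))
    * (x `^ (1 - r - s) * y) =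
    x `^ (- s) * (y `^ (s - 1) * y) + x `^ (- r) * y * (x - y) `^ (r - 1).
  have -> : x `^ (- s) = x `^ (r - 1) * x `^ (1 - r - s).
    by rewrite -powRD_gt0//; congr (_ `^ _); ring.
  have -> : x `^ (- r) = x `^ (s - 1) * x `^ (1 - r - s).
    by rewrite -powRD_gt0//; congr (_ `^ _); ring.
  by ring.
rewrite [leLHS](_ : _ = (y `^ (s - 1) * (x - y) `^ (r - 1)) *
   (x `^ (1 - r - s) * y)); last by ring.
rewrite [leRHS](_ : _ = 2 * (x `^ (r - 1) * y `^ (s - 1) +
   x `^ (s - 1) * (x - y) `^ (r - 1)) * (x `^ (1 - r - s) * y)); last by ring.
by rewrite ler_wpM2r ?mulr_ge0 ?powR_ge0 ?(ltW y0)//; exact: powR_mul_split_le.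
Qed.

(** In the variable u = y/x the integral is the Beta function B(s, r), independent of [x]. The bound
    keeps its growth of order 1/s as s tends to 0, the source of the singularity of the constant. *)
Lemma integral_hkern_y {R : realType} (s r x : R) : 0 < s -> 0 < r -> 0 < x ->
  (\int[@lebesgue_measure R]_(y in `]0%R, x[) (hkern s r x y * y^-1)%:E <=
   (2 * (s^-1 + r^-1))%:E)%E.
Proof.
move=> s0 r0 x0.
have mp (t : R) : measurable_fun `]0, x[%classic (fun y : R => (y `^ t)%:E).
  by apply/measurable_EFinP; exact: measurable_fun_powR.
have mq (t : R) : measurable_fun `]0, x[%classic (fun y : R => ((x - y) `^ t)%:E).
  apply/measurable_EFinP; apply: measurable_fun_powR.
  exact: measurable_funB.
have k1 : 0 <= 2 * x `^ (- s) by rewrite mulr_ge0 ?powR_ge0.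
have k2 : 0 <= 2 * x `^ (- r) by rewrite mulr_ge0 ?powR_ge0.
apply: (@le_trans _ _ (\int[@lebesgue_measure R]_(y in `]0%R, x[)
   ((2 * x `^ (- s))%:E * (y `^ (s - 1))%:E +
    (2 * x `^ (- r))%:E * ((x - y) `^ (r - 1))%:E))%E).
  apply: ge0_le_integral_nomeas => y /=;
    rewrite in_itv/= => /[dup] yx /andP[y0 _].
    by rewrite lee_fin mulr_ge0 ?hkern_ge0 ?invr_ge0 ?ltW.
  rewrite -!EFinM -EFinD lee_fin ler_pdivrMr//.
  apply: le_trans (hkern_le _ _ _ _ s0 r0 yx) _.
  rewrite -[X in _ * (_ * X) + _](mulr_powRB1 (ltW y0) s0).
  by rewrite le_eqVlt; apply/predU1P; left; ring.
rewrite ge0_integralD//=; first last.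
- by apply: measurable_funeM; exact: mq.
- by move=> y _; rewrite -EFinM lee_fin mulr_ge0 ?powR_ge0.
- by apply: measurable_funeM; exact: mp.
- by move=> y _; rewrite -EFinM lee_fin mulr_ge0 ?powR_ge0.
rewrite !ge0_integralZl//; try by [move=> y _;
  rewrite lee_fin powR_ge0|exact: mp|exact: mq].
rewrite integral_powR0// integral_powR_rev// -!EFinM -EFinD lee_fin.
rewrite !powRN mulrDr le_eqVlt; apply/predU1P; left; congr (_ + _).
  by field; rewrite !gt_eqF// powR_gt0.
by field; rewrite !gt_eqF// powR_gt0.
Qed.

(** The kernel depends on y/x only and dx/x is scale invariant, so this is the same Beta integral as
    in [integral_hkern_y]. *)
Lemma integral_hkern_x {R : realType} (s r y : R) : 0 < s -> 0 < r -> 0 < y ->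
  (\int[@lebesgue_measure R]_(x in `]y, +oo[) (hkern s r x y * x^-1)%:E <=
   (2 * (s^-1 + r^-1))%:E)%E.
Proof.
move=> s0 r0 y0.
have mp (t : R) : measurable_fun `]y, +oo[%classic (fun x : R => x `^ t).
  by exact: measurable_fun_powR.
have mq (t : R) : measurable_fun `]y, +oo[%classic (fun x : R => (x - y) `^ t).
  apply: measurable_fun_powR; exact: measurable_funB.
have k1 : 0 <= 2 * y `^ s by rewrite mulr_ge0 ?powR_ge0.
have m1 : measurable_fun `]y, +oo[%classic (fun x : R => (x `^ (- s - 1))%:E).
  exact/measurable_EFinP.
have m2 : measurable_fun `]y, +oo[%classic
    (fun x : R => (y * x `^ (- r - 1) * (x - y) `^ (r - 1))%:E).
  apply/measurable_EFinP; apply: measurable_funM => //.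
  exact: measurable_funM.
apply: (@le_trans _ _ (\int[@lebesgue_measure R]_(x in `]y, +oo[)
   ((2 * y `^ s)%:E * (x `^ (- s - 1))%:E +
    2%:E * (y * x `^ (- r - 1) * (x - y) `^ (r - 1))%:E))%E).
  apply: ge0_le_integral_nomeas => x /=; rewrite in_itv/= andbT => yx;
    have x0 := lt_trans y0 yx.
    by rewrite lee_fin mulr_ge0 ?hkern_ge0 ?invr_ge0 ?ltW.
  rewrite -!EFinM -EFinD lee_fin.
  have h : 0 < y < x by rewrite y0.
  apply: le_trans (ler_wpM2r _ (hkern_le _ _ _ _ s0 r0 h)) _.
    by rewrite invr_ge0 ltW.
  rewrite !(powRD_gt0 _ _ (-1) x0) powR_inv1 ?(ltW x0)//.
  by rewrite le_eqVlt; apply/predU1P; left; ring.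
rewrite ge0_integralD//=; first last.
- exact: measurable_funeM.
- by move=> x _; rewrite -EFinM lee_fin !mulr_ge0 ?powR_ge0 ?(ltW y0).
- exact: measurable_funeM.
- by move=> x _; rewrite -EFinM lee_fin mulr_ge0 ?powR_ge0.
rewrite !ge0_integralZl//; first last.
- by move=> x _; rewrite lee_fin powR_ge0.
- by move=> x _; rewrite lee_fin !mulr_ge0 ?powR_ge0 ?(ltW y0).
rewrite integral_powRy//.
have -> : (2 * (s^-1 + r^-1))%:E = ((2 * s^-1)%:E + (2 * r^-1)%:E)%E.
  by rewrite mulrDr.
apply: leeD.
  rewrite -EFinM lee_fin powRN le_eqVlt; apply/predU1P; left.
  by field; rewrite !gt_eqF// powR_gt0.
by rewrite EFinM lee_pmul2l//; exact: integral_powR_shifty_le.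
Qed.

(** * Hoelder and Tonelli *)

(** Hoelder with conjugate exponents 1/t and 1/(1-t), applied to powers of [u] and [v] extended by
    zero off [D]. The integrals on the right may be infinite. *)
Lemma hoelder_powR {R : realType} d (T : measurableType d)
    (mu : {measure set T -> \bar R}) (D : set T) (u v : T -> R) (t : R) :
  measurable D -> measurable_fun D u -> measurable_fun D v ->
  (forall x, D x -> 0 <= u x) -> (forall x, D x -> 0 <= v x) ->
  0 < t < 1 ->
  (\int[mu]_(x in D) (u x `^ t * v x `^ (1 - t))%:E <=
   poweR (\int[mu]_(x in D) (u x)%:E) t *
   poweR (\int[mu]_(x in D) (v x)%:E) (1 - t))%E.
Proof.
move=> mD mu_ mv u0 v0 /andP[t0 t1].
have t1' : 0 < 1 - t by rewrite subr_gt0.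
have mrestr (w : T -> R) (a : R) : measurable_fun D w ->
    measurable_fun setT ((fun x => w x `^ a) \_ D).
  by move=> mw; apply/(measurable_restrictT _ mD).1; exact: measurable_fun_powR.
have normE (w : T -> R) (a : R) : 0 < a -> (forall x, D x -> 0 <= w x) ->
    Lnorm mu (a^-1)%:E (EFin \o ((fun x => w x `^ a) \_ D)) =
    poweR (\int[mu]_(x in D) (w x)%:E) a.
  move=> a0 w0; rewrite unlock invrK [in RHS]integral_mkcond; congr poweR.
  apply: eq_integral => x _; rewrite /= !patchE; case: ifPn => [/set_mem Dx|_].
    rewrite ger0_norm ?powR_ge0// -powRrM mulfV ?gt_eqF// powRr1//.
    exact: w0.
  by rewrite normr0 powR0// gt_eqF// invr_gt0.
have := hoelder mu (mrestr u t mu_) (mrestr v (1 - t) mv).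
move=> /(_ t^-1 (1 - t)^-1); rewrite !invr_gt0 !invrK subrKC.
move=> /(_ t0 t1' erefl); rewrite !normE// Lnorm1; apply: le_trans.
rewrite integral_mkcond le_eqVlt; apply/predU1P; left.
apply: eq_integral => x _; rewrite /= !patchE; case: ifPn => _.
  by rewrite ger0_norm// mulr_ge0 ?powR_ge0.
by rewrite mul0r normr0.
Qed.

Lemma hoelder3_powR {R : realType} d (T : measurableType d)
    (mu : {measure set T -> \bar R}) (D : set T) (u v w : T -> R) (a b c : R) :
  measurable D ->
  measurable_fun D u -> measurable_fun D v -> measurable_fun D w ->
  (forall x, D x -> 0 <= u x) -> (forall x, D x -> 0 <= v x) ->
  (forall x, D x -> 0 <= w x) ->
  0 < a -> 0 < b -> 0 < c -> a + b + c = 1 ->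
  (\int[mu]_(x in D) (u x `^ a * v x `^ b * w x `^ c)%:E <=
   poweR (\int[mu]_(x in D) (u x)%:E) a *
   (poweR (\int[mu]_(x in D) (v x)%:E) b *
    poweR (\int[mu]_(x in D) (w x)%:E) c))%E.
Proof.
move=> mD mu_ mv mw u0 v0 w0 a0 b0 c0 abc.
have bc0 : 0 < b + c by rewrite addr_gt0.
have bcE : 1 - a = b + c by rewrite -abc; ring.
have t01 : 0 < b / (b + c) < 1.
  by rewrite divr_gt0//= ltr_pdivrMr// mul1r ltrDl.
have a01 : 0 < a < 1 by rewrite a0/= -subr_gt0 bcE.
have tE : 1 - b / (b + c) = c / (b + c) by field; rewrite gt_eqF.
have tb : b / (b + c) * (b + c) = b by rewrite divfK// gt_eqF.
have tc : c / (b + c) * (b + c) = c by rewrite divfK// gt_eqF.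
(* The two-factor inequality is applied twice: to [u] and [z] with weights a and 1 - a = b + c, then
   to [v] and [w] with the weights renormalised by b + c. *)
pose z x := v x `^ (b / (b + c)) * w x `^ (c / (b + c)).
have mz : measurable_fun D z.
  by apply: measurable_funM; exact: measurable_fun_powR.
have z0 x : D x -> 0 <= z x by move=> _; rewrite mulr_ge0 ?powR_ge0.
have -> : (\int[mu]_(x in D) (u x `^ a * v x `^ b * w x `^ c)%:E =
    \int[mu]_(x in D) (u x `^ a * z x `^ (1 - a))%:E)%E.
  apply: eq_integral => x _; rewrite /z bcE powRM ?powR_ge0// -!powRrM tb tc.
  by rewrite mulrA.
apply: le_trans (hoelder_powR _ _ mu _ _ _ _ mD mu_ mz u0 z0 a01) _.
rewrite lee_wpmul2l ?poweR_ge0// bcE.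
have h := hoelder_powR _ _ mu _ _ _ _ mD mv mw v0 w0 t01.
rewrite tE in h.
apply: le_trans (gt0_ler_poweR (ltW bc0) _ _ h) _.
- by rewrite in_itv/= leey andbT integral_ge0// => x /z0.
- by rewrite in_itv/= leey andbT mule_ge0 ?poweR_ge0.
by rewrite poweRM ?poweR_ge0// -!poweRrM tb tc.
Qed.

(** Tonelli for [phi] cut off by the indicator of the triangle 0 < y < x. The measurability of the
    inner integral comes from the same theorem and is needed later to pull a constant out of the
    outer integral. *)
Lemma tonelli_triangle {R : realType} (phi : R -> R -> \bar R) :
  measurable_fun [set: R * R] (fun z : R * R => phi z.1 z.2) ->
  (forall x y, (0 <= phi x y)%E) ->
  measurable_fun (@Rpos R)
    (fun x => \int[@lebesgue_measure R]_(y in `]0%R, x[) phi x y)%E /\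
  (\int[@lebesgue_measure R]_(x in @Rpos R)
     \int[@lebesgue_measure R]_(y in `]0%R, x[) phi x y =
   \int[@lebesgue_measure R]_(y in @Rpos R)
     \int[@lebesgue_measure R]_(x in `]y, +oo[) phi x y)%E.
Proof.
move=> mphi phi0.
pose S : set (R * R) := [set z | 0 < z.2 < z.1].
have mb : measurable_fun [set: R * R]
    (fun z : R * R => (0 < z.2) && (z.2 < z.1)).
  by apply: measurable_and; exact: measurable_fun_ltr.
have mS : measurable S.
  have := mb measurableT [set true] I; rewrite setTI.
  by congr measurable; apply/seteqP; split.
pose G := (fun z : R * R => phi z.1 z.2) \_ S.
have mG : measurable_fun setT G.
  apply/(measurable_restrictT _ mS).
  apply: measurable_funTS.
  exact: mphi.
have G0 z : (0 <= G z)%E by apply: erestrict_ge0.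
have GE x y : G (x, y) = if 0 < y < x then phi x y else 0%E.
  rewrite /G patchE; case: ifPn => [|h]; first by rewrite inE /S/= => ->.
  by case: ifPn => // h'; move: h; rewrite notin_setE.
have G1 x : Rpos x -> (\int[@lebesgue_measure R]_y G (x, y) =
    \int[@lebesgue_measure R]_(y in `]0%R, x[) phi x y)%E.
  move=> _; rewrite [RHS]integral_mkcond; apply: eq_integral => y _.
  by rewrite GE patchE mem_setE in_itv.
have G2 y : Rpos y -> (\int[@lebesgue_measure R]_x G (x, y) =
    \int[@lebesgue_measure R]_(x in `]y, +oo[) phi x y)%E.
  rewrite /Rpos/= in_itv/= andbT => y0.
  rewrite [RHS]integral_mkcond; apply: eq_integral => x _.
  by rewrite GE patchE mem_setE in_itv/= y0 andbT.
have mF := @measurable_fun_fubini_tonelli_F _ _ _ _ R (@lebesgue_measure R) G mG G0.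
have FT := @fubini_tonelli _ _ _ _ R (@lebesgue_measure R) (@lebesgue_measure R) G mG G0.
have mR : measurable (@Rpos R) by exact: measurable_itv.
split.
  apply: (eq_measurable_fun (fun x => \int[@lebesgue_measure R]_y G (x, y))%E).
    by move=> x /set_mem; exact: G1.
  exact: measurable_funTS mF.
transitivity (\int[@lebesgue_measure R]_x \int[@lebesgue_measure R]_y G (x, y))%E.
  rewrite integral_mkcond; apply: eq_integral => x _; rewrite patchE.
  case: ifPn => [/set_mem/G1//|];
    rewrite notin_setE /Rpos/= in_itv/= andbT => x0.
  apply/esym/integral0_eq => y _; rewrite GE; case: ifPn => // /andP[h1 h2].
  by case: x0; exact: lt_trans h2.
rewrite FT [RHS]integral_mkcond; apply: eq_integral => y _; rewrite patchE.
case: ifPn => [/set_mem/G2//|]; rewrite notin_setE /Rpos/= in_itv/= andbT => y0.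
by apply: integral0_eq => x _; rewrite GE; case: ifPn => // /andP[].
Qed.

(** * Upper bound *)

(** The weights 1/q, 1-k and 1-1/p sum to 1, ready for [hoelder3_powR]. The split rests on k = 1/q +
    (1-1/p) for the kernel, 1/p = 1/q + (1-k) for [F], and a + e = 1-1/p for the power of [y]; the
    [k]-th power of the kernel is y^e x^(l-e) (x-y)^(-l), whose power of [x] the prefactor
    cancels. *)
Lemma hkern_factorization {R : realType} (a b l k e p q x y F : R) :
  k = a + b + l -> 0 < k -> 0 < p -> p^-1 = 1 - a - e -> q^-1 = b + l - e ->
  0 < y < x -> 0 <= F ->
  y `^ (- a) * F * (x - y) `^ (- l) =
  x `^ (e - l) *
   ((hkern (e / k) (1 - l / k) x y * F `^ p) `^ q^-1 * (F `^ p) `^ (1 - k) *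
    (hkern (e / k) (1 - l / k) x y * y^-1) `^ (1 - p^-1)).
Proof.
move=> kE k0 p0 pE qE /andP[y0 yx] F0; have x0 := lt_trans y0 yx.
have xy0 : 0 < x - y by rewrite subr_gt0.
have kN : k != 0 by rewrite gt_eqF.
set H := hkern _ _ _ _.
have H0 : 0 < H by rewrite !mulr_gt0 ?powR_gt0.
have HK : H `^ k = y `^ e * x `^ (l - e) * (x - y) `^ (- l).
  rewrite /H /hkern !powRM ?mulr_ge0 ?powR_ge0// -!powRrM.
  by congr (_ `^ _ * _ `^ _ * _ `^ _); field.
have FE : F = F `^ (p * q^-1) * F `^ (p * (1 - k)).
  have h : p * q^-1 + p * (1 - k) = 1.
    by rewrite -mulrDr -[RHS](mulfV (lt0r_neq0 p0)) pE qE kE; congr (_ * _);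
      ring.
  by rewrite -powRD h ?oner_eq0// powRr1.
have HE : H `^ k = H `^ q^-1 * H `^ (1 - p^-1).
  by rewrite -powRD_gt0//; congr (_ `^ _); rewrite pE qE kE; ring.
have yE : y `^ (- a) = y `^ e * y^-1 `^ (1 - p^-1).
  rewrite -(powR_inv1 (ltW y0)) -powRrM -powRD_gt0//; congr (_ `^ _).
  by rewrite pE; ring.
have xE : x `^ (e - l) * x `^ (l - e) = 1.
  by rewrite -powRD_gt0// (_ : _ + _ = 0) ?powRr0//; ring.
clearbody H.
rewrite !powRM ?powR_ge0 ?invr_ge0 ?(ltW H0) ?(ltW y0)//.
rewrite -!powRrM.
transitivity (x `^ (e - l) * H `^ k * (F `^ (p * q^-1) * F `^ (p * (1 - k)))
  * y^-1 `^ (1 - p^-1)); last by rewrite HE; ring.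
rewrite -FE HK yE.
transitivity ((x `^ (e - l) * x `^ (l - e)) * (y `^ e * y^-1 `^ (1 - p^-1) * F *
   (x - y) `^ (- l))); last by ring.
by rewrite xE mul1r.
Qed.

(** [fine] sends both infinities to 0, so upper bounds for [Uop] hold even at points where the inner
    integral diverges. *)
Lemma lee_fine_norm {R : realType} (z : \bar R) : ((`|fine z|)%:E <= `|z|)%E.
Proof. by case: z => [z||]//=; rewrite normr0 leey. Qed.

Lemma measurable_hkern {R : realType} (s r : R) :
  measurable_fun [set: R * R] (fun z : R * R => hkern s r z.1 z.2).
Proof.
apply: measurable_funM; first apply: measurable_funM.
- by apply: measurable_fun_powR; exact: measurable_snd.
- by apply: measurable_fun_powR; exact: measurable_fst.
- by apply: measurable_fun_powR; apply: measurable_funB;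
    [exact: measurable_fst|exact: measurable_snd].
Qed.

Lemma measurable_hkern1 {R : realType} (s r y : R) (D : set R) :
  measurable_fun D (fun x : R => hkern s r x y).
Proof.
apply: measurable_funM; first apply: measurable_funM => //.
- exact: measurable_fun_powR.
- by apply: measurable_fun_powR; exact: measurable_funB.
Qed.

Lemma measurable_hkern2 {R : realType} (s r x : R) (D : set R) :
  measurable_fun D (fun y : R => hkern s r x y).
Proof.
apply: measurable_funM; first apply: measurable_funM => //.
- exact: measurable_fun_powR.
- by apply: measurable_fun_powR; exact: measurable_funB.
Qed.

(** The pointwise half of the proof of Young's inequality: three-factor Hoelder in [y] for the
    factorization above. The prefactor combines x^(-b) with x^(e-l), since 1/q = b + l - e. *)
Lemma Uop_le {R : realType} (a b l k e p q : R) (f : R -> R) (x : R) :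
  k = a + b + l -> 0 < k < 1 -> 0 < e -> l < k -> 0 < p ->
  p^-1 = 1 - a - e -> q^-1 = b + l - e -> 0 < q -> 0 < a ->
  measurable_fun (@Rpos R) f -> 0 < x ->
  ((`|Uop a b l f x|)%:E <=
   (x `^ (- q^-1))%:E *
   (poweR (\int[@lebesgue_measure R]_(y in `]0%R, x[)
             (hkern (e / k) (1 - l / k) x y * `|f y| `^ p)%:E) q^-1 *
    (poweR (\int[@lebesgue_measure R]_(y in @Rpos R) (`|f y| `^ p)%:E) (1 - k) *
     ((2 * ((e / k)^-1 + (1 - l / k)^-1)) `^ (1 - p^-1))%:E)))%E.
Proof.
move=> kE /andP[k0 k1] e0 lk p0 pE qE q0 a0 mf x0.
have s0 : 0 < e / k by rewrite divr_gt0.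
have r0 : 0 < 1 - l / k by rewrite subr_gt0 ltr_pdivrMr// mul1r.
have sub : `]0, x[%classic `<=` @Rpos R.
  by move=> y /=; rewrite /Rpos/= !in_itv/= => /andP[-> _].
have mI : measurable (`]0, x[%classic : set R) by exact: measurable_itv.
have mf' : measurable_fun (`]0, x[%classic : set R) f.
  by apply: measurable_funS mf => //; exact: measurable_itv.
have mfp : measurable_fun (`]0, x[%classic : set R) (fun y => `|f y| `^ p).
  by apply: measurable_fun_powR; exact: measurableT_comp.
set H := hkern (e / k) (1 - l / k) x.
rewrite /Uop normrM (ger0_norm (powR_ge0 _ _)) EFinM.
have -> : x `^ (- q^-1) = x `^ (- b) * x `^ (e - l).
  by rewrite -powRD_gt0// qE; congr (_ `^ _); ring.
rewrite EFinM -muleA lee_wpmul2l ?lee_fin ?powR_ge0//.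
apply: le_trans (lee_fine_norm _) _.
apply: le_trans (le_abse_integral _ _ _) _ => //.
  apply/measurable_EFinP; apply: measurable_funM;
    first apply: measurable_funM => //.
    exact: measurable_fun_powR.
  by apply: measurable_fun_powR; apply: measurableT_comp => //;
    exact: measurable_funB.
have -> : (\int[@lebesgue_measure R]_(y in `]0%R, x[)
      `|(y `^ (- a) * f y * `|x - y| `^ (- l))%:E| =
    \int[@lebesgue_measure R]_(y in `]0%R, x[) ((x `^ (e - l))%:E *
      ((H y * `|f y| `^ p) `^ q^-1 * (`|f y| `^ p) `^ (1 - k) *
       (H y * y^-1) `^ (1 - p^-1))%:E))%E.
  apply: eq_integral => y; rewrite inE/= in_itv/= => /[dup] yx /andP[y0 yx'].
  rewrite -EFinM !normrM !(ger0_norm (powR_ge0 _ _)).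
  rewrite (ger0_norm (x := x - y)) ?subr_ge0 ?(ltW yx')//.
  by rewrite (hkern_factorization a b l k e p q).
have mH : measurable_fun (`]0, x[%classic : set R) H by exact: measurable_hkern2.
have mv : measurable_fun (`]0, x[%classic : set R) (fun y : R => y^-1).
  apply: (eq_measurable_fun (fun y : R => y `^ (-1))).
    by move=> y; rewrite inE/= in_itv/= => /andP[y0 _]; rewrite powR_inv1// ltW.
  exact: measurable_fun_powR.
have mu1 : measurable_fun (`]0, x[%classic : set R) (fun y => H y * `|f y| `^ p).
  exact: measurable_funM.
have mu3 : measurable_fun (`]0, x[%classic : set R) (fun y => H y * y^-1).
  exact: measurable_funM.
rewrite ge0_integralZl//; first last.
- by rewrite lee_fin powR_ge0.
- by move=> y _; rewrite lee_fin !mulr_ge0 ?powR_ge0.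
- apply/measurable_EFinP; apply: measurable_funM; first apply: measurable_funM;
    exact: measurable_fun_powR.
rewrite lee_wpmul2l ?lee_fin ?powR_ge0//.
have h3 := @hoelder3_powR R _ _ (@lebesgue_measure R) _ _ _ _ q^-1 (1 - k)
  (1 - p^-1) mI mu1 mfp mu3.
apply: le_trans (h3 _ _ _ _ _ _ _) _.
- by move=> y _; rewrite mulr_ge0 ?hkern_ge0 ?powR_ge0.
- by move=> y _; rewrite powR_ge0.
- by move=> y /=; rewrite in_itv/= => /andP[y0 _];
    rewrite mulr_ge0 ?hkern_ge0 ?invr_ge0 ?ltW.
- by rewrite invr_gt0.
- by rewrite subr_gt0.
- by rewrite pE; lra.
- by rewrite pE qE kE; ring.
rewrite lee_wpmul2l ?poweR_ge0//.
have pp0 : 0 <= 1 - p^-1 by rewrite pE; lra.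
(* The first Hoelder factor is kept. The second is enlarged to an integral over [Rpos] and the third
   is bounded uniformly in [x]. *)
apply: lee_pmul; rewrite ?poweR_ge0//.
  apply: gt0_ler_poweR.
  - by rewrite subr_ge0 ltW.
  - by rewrite in_itv/= leey andbT integral_ge0// => y _;
      rewrite lee_fin powR_ge0.
  - by rewrite in_itv/= leey andbT integral_ge0// => y _;
      rewrite lee_fin powR_ge0.
  - apply: ge0_subset_integral => //; first exact: measurable_itv.
    by apply/measurable_EFinP; apply: measurable_fun_powR;
      exact: measurableT_comp.
rewrite -poweR_EFin; apply: gt0_ler_poweR => //.
- rewrite in_itv/= leey andbT integral_ge0// => y /=;
    rewrite in_itv/= => /andP[y0 _].
  by rewrite lee_fin mulr_ge0 ?hkern_ge0 ?invr_ge0 ?ltW.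
- by rewrite in_itv/= leey andbT lee_fin mulr_ge0// addr_ge0// invr_ge0 ltW.
- exact: integral_hkern_y.
Qed.

(** The integrated half of Young's inequality. The weight [x^-1] is the [q]-th power of the
    prefactor in [Uop_le]; exchanging the integrals leaves the kernel integrated in dx/x, to which
    [integral_hkern_x] applies. *)
Lemma integral_hkern_triangle_le {R : realType} (s r p : R) (f : R -> R) :
  0 < s -> 0 < r -> measurable_fun (@Rpos R) f ->
  measurable_fun (@Rpos R) (fun x => (x^-1)%:E *
    \int[@lebesgue_measure R]_(y in `]0%R, x[)
      (hkern s r x y * `|f y| `^ p)%:E)%E /\
  (\int[@lebesgue_measure R]_(x in @Rpos R) ((x^-1)%:E *
    \int[@lebesgue_measure R]_(y in `]0%R, x[)
      (hkern s r x y * `|f y| `^ p)%:E) <=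
   (2 * (s^-1 + r^-1))%:E *
   \int[@lebesgue_measure R]_(y in @Rpos R) (`|f y| `^ p)%:E)%E.
Proof.
move=> s0 r0 mf.
have mR : measurable (@Rpos R) by exact: measurable_itv.
have mfp : measurable_fun (@Rpos R) (fun y => `|f y| `^ p).
  by apply: measurable_fun_powR; exact: measurableT_comp.
have M0 : 0 <= 2 * (s^-1 + r^-1).
  by rewrite mulr_ge0// addr_ge0// invr_ge0 ltW.
(* Tonelli wants a nonnegative measurable function on the whole plane: [f] is extended by zero, and
   in [phi] the real power of exponent -1 replaces [x^-1], which is negative for x < 0. *)
pose g := f \_ (@Rpos R).
have mg : measurable_fun [set: R] g by exact/(measurable_restrictT _ mR).
have gE y : 0 < y -> g y = f y.
  by move=> y0; rewrite /g patchE mem_set// /Rpos/= in_itv/= y0.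
pose phi x y := (hkern s r x y * x `^ (-1) * `|g y| `^ p)%:E.
have inner x : Rpos x -> ((x^-1)%:E * \int[@lebesgue_measure R]_(y in `]0%R, x[)
      (hkern s r x y * `|f y| `^ p)%:E =
    \int[@lebesgue_measure R]_(y in `]0%R, x[) phi x y)%E.
  rewrite /Rpos/= in_itv/= andbT => x0.
  have sub : `]0, x[%classic `<=` @Rpos R.
    by move=> y /=; rewrite /Rpos/= !in_itv/= => /andP[-> _].
  rewrite -ge0_integralZl; first last.
  - by rewrite lee_fin invr_ge0 ltW.
  - by move=> y _; rewrite lee_fin mulr_ge0 ?hkern_ge0 ?powR_ge0.
  - apply/measurable_EFinP; apply: measurable_funM;
      first exact: measurable_hkern2.
    exact: measurable_funS mfp.
  - exact: measurable_itv.
  apply: eq_integral => y; rewrite inE/= in_itv/= => /andP[y0 _].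
  by rewrite -EFinM /phi gE// powR_inv1 ?(ltW x0)//; congr EFin; ring.
have mphi : measurable_fun [set: R * R] (fun z : R * R => phi z.1 z.2).
  apply/measurable_EFinP; apply: measurable_funM; first apply: measurable_funM.
  - exact: measurable_hkern.
  - by apply: measurable_fun_powR; exact: measurable_fst.
  - apply: measurable_fun_powR; apply: measurableT_comp => //.
    by apply: measurableT_comp => //; exact: measurable_snd.
have phi0 x y : (0 <= phi x y)%E.
  by rewrite lee_fin !mulr_ge0 ?hkern_ge0 ?powR_ge0.
have [mT eT] := tonelli_triangle phi mphi phi0.
split.
  by apply: eq_measurable_fun mT => x /set_mem/inner ->.
rewrite [leLHS](_ : _ = \int[@lebesgue_measure R]_(x in @Rpos R)
    \int[@lebesgue_measure R]_(y in `]0%R, x[) phi x y)%E; last first.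
  by apply: eq_integral => x /set_mem; exact: inner.
rewrite eT {inner mphi mT eT} -ge0_integralZl; first last.
- by rewrite lee_fin.
- by move=> y _; rewrite lee_fin powR_ge0.
- exact/measurable_EFinP.
- exact: mR.
apply: ge0_le_integral_nomeas => y /=.
  by move=> _; apply: integral_ge0 => x _; exact: phi0.
rewrite /Rpos/= in_itv/= andbT => y0.
have -> : (\int[@lebesgue_measure R]_(x in `]y, +oo[) phi x y =
   \int[@lebesgue_measure R]_(x in `]y, +oo[)
     ((`|f y| `^ p)%:E * (hkern s r x y * x `^ (-1))%:E))%E.
  by apply: eq_integral => x _; rewrite -EFinM /phi gE// mulrC.
rewrite ge0_integralZl; first last.
- by rewrite lee_fin powR_ge0.
- by move=> x _; rewrite lee_fin mulr_ge0 ?hkern_ge0 ?powR_ge0.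
- apply/measurable_EFinP; apply: measurable_funM;
    last exact: measurable_fun_powR.
  exact: measurable_hkern1.
- exact: measurable_itv.
rewrite muleC lee_wpmul2r ?lee_fin ?powR_ge0//.
apply: le_trans (integral_hkern_x s r y s0 r0 y0).
rewrite le_eqVlt; apply/predU1P; left.
apply: eq_integral => x; rewrite inE/= in_itv/= andbT => yx.
by rewrite powR_inv1// ltW// (lt_trans y0).
Qed.

(** Raising [Uop_le] to the power q and integrating gives a bound by [C * (M * n)]. In its [q]-th
    root the exponent of [M] is 1 - 1/p + 1/q = k and that of [n] is 1 - k + 1/q = 1/p. *)
Lemma normLp_Uop_le {R : realType} (a b l k e p q : R) (f : R -> R) :
  k = a + b + l -> 0 < k < 1 -> 0 < e -> l < k -> 0 < p ->
  p^-1 = 1 - a - e -> q^-1 = b + l - e -> 0 < q -> 0 < a ->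
  inLp p f ->
  (normLp q (Uop a b l f) <=
   ((2 * ((e / k)^-1 + (1 - l / k)^-1)) `^ k)%:E * normLp p f)%E.
Proof.
move=> kE k01 e0 lk p0 pE qE q0 a0 [mf fLp].
have /andP[k0 k1] := k01.
have s0 : 0 < e / k by rewrite divr_gt0.
have r0 : 0 < 1 - l / k by rewrite subr_gt0 ltr_pdivrMr// mul1r.
have qN : q != 0 by rewrite gt_eqF.
have qV : q^-1 != 0 by rewrite invr_eq0.
set M := 2 * _; have M0 : 0 < M by rewrite mulr_gt0// addr_gt0// invr_gt0.
have [mA AM] := integral_hkern_triangle_le (e / k) (1 - l / k) p f s0 r0 mf.
move: fLp.
pose N := (\int[@lebesgue_measure R]_(x in @Rpos R) (`|f x| `^ p)%:E)%E.
have normE : normLp p f = poweR N p^-1 by [].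
rewrite normE; rewrite -/N in AM.
have N0 : (0 <= N)%E by apply: integral_ge0 => x _; rewrite lee_fin powR_ge0.
move=> /(lty_poweRy _); rewrite invr_eq0 gt_eqF// => /(_ isT) Nfin.
have [n nE] : exists n, N = n%:E.
  by exists (fine N); rewrite fineK// ge0_fin_numE.
have n0 : 0 <= n by rewrite -lee_fin -nE.
pose C := (n `^ (1 - k) * M `^ (1 - p^-1)) `^ q.
have C0 : 0 <= C by exact: powR_ge0.
pose I := (\int[@lebesgue_measure R]_(x in @Rpos R)
  (`|Uop a b l f x| `^ q)%:E)%E.
rewrite -[normLp q _]/(poweR I q^-1).
have IC : (I <= (C * (M * n))%:E)%E.
  apply: (@le_trans _ _ (\int[@lebesgue_measure R]_(x in @Rpos R) (C%:E * ((x^-1)%:E *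
    \int[@lebesgue_measure R]_(y in `]0%R, x[)
      (hkern (e / k) (1 - l / k) x y * `|f y| `^ p)%:E)))%E).
    apply: ge0_le_integral_nomeas => x.
      by move=> _; rewrite lee_fin powR_ge0.
    rewrite /Rpos/= in_itv/= andbT => x0.
    have h := Uop_le a b l k e p q f x kE k01 e0 lk p0 pE qE q0 a0 mf x0.
    rewrite -poweR_EFin; apply: le_trans (gt0_ler_poweR (ltW q0) _ _ h) _.
    - by rewrite in_itv/= leey andbT lee_fin.
    - by rewrite in_itv/= leey andbT !mule_ge0 ?poweR_ge0 ?lee_fin ?powR_ge0.
    rewrite -/N nE poweR_EFin.
    rewrite !poweRM ?mule_ge0 ?poweR_ge0 ?lee_fin ?powR_ge0//.
    rewrite -poweRrM mulVf// poweRe1; last first.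
      by apply: integral_ge0 => y _;
        rewrite lee_fin mulr_ge0 ?hkern_ge0 ?powR_ge0.
    rewrite !poweR_EFin -powRrM mulNr mulVf// powR_inv1 ?(ltW x0)//.
    rewrite /C powRM ?powR_ge0// EFinM.
    by rewrite -/M muleA muleC.
  rewrite ge0_integralZl//; first last.
  - move=> x; rewrite /Rpos/= in_itv/= andbT => x0.
    rewrite mule_ge0 ?lee_fin ?invr_ge0 ?(ltW x0)//.
    by apply: integral_ge0 => y _;
      rewrite lee_fin mulr_ge0 ?hkern_ge0 ?powR_ge0.
  - exact: measurable_itv.
  rewrite EFinM lee_wpmul2l ?lee_fin//.
  by apply: le_trans AM _; rewrite nE -EFinM.
have I0 : (0 <= I)%E by apply: integral_ge0 => x _; rewrite lee_fin powR_ge0.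
clearbody M.
apply: le_trans (gt0_ler_poweR _ _ _ IC) _.
- by rewrite invr_ge0 ltW.
- by rewrite in_itv/= leey andbT.
- by rewrite in_itv/= leey andbT lee_fin !mulr_ge0// ?(ltW M0).
rewrite nE !poweR_EFin -EFinM lee_fin le_eqVlt; apply/predU1P; left.
rewrite /C powRM ?mulr_ge0 ?(ltW M0)// -powRrM mulfV// powRr1 ?mulr_ge0
  ?powR_ge0//.
rewrite powRM ?(ltW M0)//.
transitivity ((M `^ (1 - p^-1) * M `^ q^-1) * (n `^ (1 - k) * n `^ q^-1));
  first by ring.
(* Here [n] may be 0, so adding its exponents requires a nonzero sum, which [p^-1] provides. *)
have hp : p^-1 = (1 - k) + q^-1 by rewrite pE qE kE; ring.
rewrite -(powRD_gt0 _ _ _ M0) -powRD -?hp ?invr_eq0 ?(gt_eqF p0)//.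
by congr (_ `^ _ * _); rewrite pE qE kE; ring.
Qed.

(** * Lower bound *)

(** A base in (0, 1] does not decrease under an exponent at most 1. It bounds the factors t^t of the
    Hardy quotient from below, uniformly in [p]. *)
Lemma le_powR_self {R : realType} (c t : R) : 0 < c -> c <= t -> t <= 1 ->
  c <= t `^ t.
Proof.
move=> c0 ct t1; have t0 := lt_le_trans c0 ct.
by rewrite (le_trans ct)// ger1_powR// t0.
Qed.

Lemma integral_patch_subset {R : realType} (A B : set R) (g : R -> \bar R) :
  A `<=` B ->
  (\int[@lebesgue_measure R]_(x in B) ((g \_ A) x) =
   \int[@lebesgue_measure R]_(x in A) g x)%E.
Proof.
move=> AB; rewrite integral_mkcond [RHS]integral_mkcond.
apply: eq_integral => x _; rewrite !patchE.
by case: ifPn => // xB; case: ifPn => // /set_mem/AB/mem_set xA;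
  rewrite xA in xB.
Qed.

Lemma integral_cst_powR01 {R : realType} (c d : R) : 0 < d -> 0 <= c ->
  (\int[@lebesgue_measure R]_(y in `]0%R, 1%R[) (c%:E * (y `^ (d - 1))%:E) =
   (c * d^-1)%:E)%E.
Proof.
move=> d0 c0; rewrite ge0_integralZl.
- by rewrite integral_powR0// powR1 mul1r -EFinM.
- exact: measurable_itv.
- by apply/measurable_EFinP; exact: measurable_fun_powR.
- by move=> y _; rewrite lee_fin powR_ge0.
- by rewrite lee_fin.
Qed.

(** For c = (d-1)/p with c - a = d - 1, both f^p and y^(-a) f equal y^(d-1) on (0, 1): the equality
    case of Hoelder for the integral of y^(-a) f over (0, 1). *)
Definition hardy_extremal {R : realType} (c : R) : R -> R :=
  (fun y : R => y `^ c) \_ `]0, 1[%classic.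

Lemma normLp_hardy_extremal {R : realType} (d p : R) : 0 < d -> 0 < p ->
  normLp p (hardy_extremal ((d - 1) / p)) = (d^-1 `^ p^-1)%:E.
Proof.
move=> d0 p0; rewrite /normLp -poweR_EFin; congr (poweR _ _).
have <- : (\int[@lebesgue_measure R]_(y in `]0%R, 1%R[) (y `^ (d - 1))%:E =
    (d^-1)%:E)%E by rewrite integral_powR0// powR1 mul1r.
rewrite -[RHS](@integral_patch_subset _ _ (@Rpos R)); last first.
  by move=> x; rewrite /Rpos/= !in_itv/= => /andP[->].
apply: eq_integral => y _; rewrite /hardy_extremal !patchE.
case: ifPn => _; last by rewrite normr0 powR0// gt_eqF.
by rewrite ger0_norm ?powR_ge0// -powRrM divfK// gt_eqF.
Qed.

(** For 0 < y < 1 < x one has (x-y)^(-l) >= x^(-l), and the remaining integral of y^(d-1) over (0,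
    1) is 1/d. *)
Lemma Uop_hardy_extremal_ge {R : realType} (a b l d p x : R) :
  0 < l -> 0 < d -> (d - 1) / p - a = d - 1 -> 1 < x ->
  d^-1 * x `^ (- (b + l)) <=
  `|Uop a b l (hardy_extremal ((d - 1) / p)) x|.
Proof.
move=> l0 d0 dE x1; have x0 : 0 < x by rewrite (lt_trans _ x1).
have I1 : (\int[@lebesgue_measure R]_(y in `]0%R, x[)
    (y `^ (- a) * hardy_extremal ((d - 1) / p) y * `|x - y| `^ (- l))%:E =
   \int[@lebesgue_measure R]_(y in `]0%R, 1%R[)
     (y `^ (d - 1) * (x - y) `^ (- l))%:E)%E.
  rewrite -[RHS](@integral_patch_subset _ _ `]0, x[%classic); last first.
    by move=> y /=; rewrite !in_itv/= => /andP[->/= /lt_trans]; exact.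
  apply: eq_integral => y _; rewrite /hardy_extremal !patchE.
  case: ifPn; last by rewrite mulr0 mul0r.
  rewrite inE/= in_itv/= => /andP[y0 y1].
  rewrite -powRD_gt0// addrC dE ger0_norm// subr_ge0.
  by rewrite ltW// (lt_trans y1).
have intc c := @integral_cst_powR01 R c _ d0.
rewrite /Uop normrM (ger0_norm (powR_ge0 _ _)) I1 {I1}.
set I := (\int[_]_(y in _) _)%E.
have lo : ((x `^ (- l) * d^-1)%:E <= I)%E.
  rewrite -(intc _ (powR_ge0 _ _)); apply: ge0_le_integral_nomeas => y /=.
    by move=> _; rewrite -EFinM lee_fin mulr_ge0 ?powR_ge0.
  rewrite in_itv/= => /andP[y0 y1]; rewrite -EFinM lee_fin mulrC.
  have xy : 0 < x - y by rewrite subr_gt0 (lt_trans y1).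
  rewrite ler_wpM2l ?powR_ge0// !powRN lef_pV2 ?posrE ?powR_gt0//.
  by rewrite ge0_ler_powR ?nnegrE ?(ltW l0) ?(ltW x0) ?(ltW xy)// gerBl ltW.
(* The upper bound serves finiteness only: [fine] would turn an infinite integral into 0 and destroy
   the lower bound. *)
have up : (I <= ((x - 1) `^ (- l) * d^-1)%:E)%E.
  rewrite -(intc _ (powR_ge0 _ _)); apply: ge0_le_integral_nomeas => y /=.
    by move=> _; rewrite lee_fin mulr_ge0 ?powR_ge0.
  rewrite in_itv/= => /andP[y0 y1]; rewrite -EFinM lee_fin mulrC.
  have xy : 0 < x - y by rewrite subr_gt0 (lt_trans y1).
  have x10 : 0 < x - 1 by rewrite subr_gt0.
  rewrite ler_wpM2r ?powR_ge0// !powRN lef_pV2 ?posrE ?powR_gt0//.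
  rewrite ge0_ler_powR ?nnegrE ?(ltW l0) ?(ltW x10) ?(ltW xy)//.
  by rewrite lerB// ltW.
have Ifin : I \is a fin_num.
  rewrite ge0_fin_numE; first exact: le_lt_trans up (ltry _).
  by apply: le_trans lo; rewrite lee_fin mulr_ge0 ?powR_ge0// invr_ge0 ltW.
have lo' : x `^ (- l) * d^-1 <= fine I by rewrite -lee_fin fineK.
rewrite opprD powRD_gt0// mulrCA ler_wpM2l ?powR_ge0//.
by rewrite mulrC (le_trans lo')// ler_norm.
Qed.

(** The quotient of the test function is at least t^t (1/q)^(1/q) / e^k with t = a + e. Since 0 < e
    <= l, t lies in [a, 1] and 1/q = b + l - e in [b, 1], which gives the factor [a * b]. *)
Lemma Kconst_ge {R : realType} (a b l k e p : R) :
  k = a + b + l -> 0 < a -> 0 < b -> 0 < l -> k < 1 -> 0 < e -> e <= l ->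
  p^-1 = 1 - a - e ->
  ((a * b / e `^ k)%:E <= Kconst a b l p)%E.
Proof.
move=> kE a0 b0 l0 k1 e0 el pE.
have p0 : 0 < p by rewrite -invr_gt0 pE; lra.
have qE : (qexp a b l p)^-1 = b + l - e by rewrite /qexp invrK pE; ring.
set q := qexp a b l p in qE *.
have q0 : 0 < q by rewrite -invr_gt0 qE; lra.
(* [t] is 1/p' for the conjugate exponent p', and [d] = e/t = 1 - a p' is the value for which
   (d-1)/p - a = d - 1. *)
pose t := a + e; have t0 : 0 < t by rewrite addr_gt0.
pose d := e / t; have d0 : 0 < d by rewrite divr_gt0.
have pt : p^-1 = 1 - t by rewrite pE /t; ring.
have dE : (d - 1) / p - a = d - 1.
  by rewrite pt /d /t; field; rewrite gt_eqF.
pose f := hardy_extremal ((d - 1) / p).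
have nf : normLp p f = (d^-1 `^ p^-1)%:E by exact: normLp_hardy_extremal.
have nf0 : 0 < d^-1 `^ p^-1 by rewrite powR_gt0// invr_gt0.
have fLp : inLp p f.
  split; last by rewrite nf ltry.
  apply: measurable_funTS.
  have mI : measurable (`]0, 1[%classic : set R) by exact: measurable_itv.
  by apply/(measurable_restrictT _ mI); exact: measurable_fun_powR.
apply: (@le_trans _ _ (normLp q (Uop a b l f) * ((fine (normLp p f))^-1)%:E)%E); last first.
  apply: ereal_sup_ubound; exists f => //; split => //.
  by rewrite nf eqe gt_eqF.
have qe0 : 0 < q * e by rewrite mulr_gt0.
have low : ((d^-1 * (q * e)^-1 `^ q^-1)%:E <= normLp q (Uop a b l f))%E.
  have -> : d^-1 * (q * e)^-1 `^ q^-1 = (d^-1 `^ q * (q * e)^-1) `^ q^-1.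
    rewrite powRM ?powR_ge0 ?invr_ge0 ?(ltW qe0)// -powRrM mulfV ?gt_eqF//.
    by rewrite powRr1// invr_ge0 ltW.
  rewrite /normLp -poweR_EFin; apply: gt0_ler_poweR.
  - by rewrite invr_ge0 ltW.
  - by rewrite in_itv/= leey andbT lee_fin mulr_ge0 ?powR_ge0// invr_ge0 ltW.
  - rewrite in_itv/= leey andbT; apply: integral_ge0 => x _.
    by rewrite lee_fin powR_ge0.
  (* Since q(b + l) = 1 + qe, the [q]-th power of x^(-(b+l)) is x^(-qe-1), with integral 1/(qe) over
     (1, +oo). *)
  have <- : (\int[@lebesgue_measure R]_(x in `]1%R, +oo[)
     ((d^-1 `^ q)%:E * (x `^ (- (q * e) - 1))%:E) =
     (d^-1 `^ q * (q * e)^-1)%:E)%E.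
    rewrite ge0_integralZl//.
    - by rewrite integral_powRy// powR1 mul1r -EFinM.
    - by apply/measurable_EFinP; exact: measurable_fun_powR.
    - by move=> x _; rewrite lee_fin powR_ge0.
    - by rewrite lee_fin powR_ge0.
  rewrite -(@integral_patch_subset _ _ (@Rpos R)); last first.
    by move=> x; rewrite /Rpos/= !in_itv/= !andbT; exact: lt_trans.
  apply: ge0_le_integral_nomeas => x _.
    by apply: erestrict_ge0 => y _; rewrite -EFinM lee_fin mulr_ge0 ?powR_ge0.
  rewrite patchE; case: ifPn; last by rewrite lee_fin powR_ge0.
  rewrite inE/= in_itv/= andbT => x1; rewrite -EFinM lee_fin.
  have h := Uop_hardy_extremal_ge a b l d p x l0 d0 dE x1.
  have -> : d^-1 `^ q * x `^ (- (q * e) - 1) = (d^-1 * x `^ (- (b + l))) `^ q.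
    rewrite powRM ?powR_ge0 ?invr_ge0 ?(ltW d0)// -powRrM; congr (_ * _ `^ _).
    have -> : b + l = q^-1 + e by rewrite qE; ring.
    by field; rewrite gt_eqF.
  apply: ge0_ler_powR => //; first exact: ltW.
  by rewrite nnegrE mulr_ge0 ?powR_ge0// invr_ge0 ltW.
apply: le_trans (lee_wpmul2r _ low); last by rewrite lee_fin invr_ge0 nf ltW.
rewrite nf -EFinM lee_fin /=.
(* Dividing by the norm leaves d^(-t) = t^t e^(-t), because 1 - 1/p = t; the total exponent of 1/e
   is then t + 1/q = k. *)
have -> : d^-1 * (q * e)^-1 `^ q^-1 / d^-1 `^ p^-1 =
    t `^ t * q^-1 `^ q^-1 / e `^ k.
  have iq0 : 0 < q^-1 by rewrite invr_gt0.
  have ie0 : 0 < e^-1 by rewrite invr_gt0.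
  have id0 : 0 < d^-1 by rewrite invr_gt0.
  have D1 : d^-1 = d^-1 `^ t * d^-1 `^ p^-1.
    by rewrite -powRD_gt0// pt subrKC powRr1// ltW.
  have D2 : d^-1 `^ t = t `^ t * e^-1 `^ t.
    by rewrite invf_div powRM// ?(ltW t0) ?(ltW ie0).
  have ek : (e `^ k)^-1 = e^-1 `^ t * e^-1 `^ q^-1.
    rewrite -powRD_gt0// -(powR_inv1 (ltW e0)) -powRrM -powRN.
    by congr (_ `^ _); rewrite qE /t kE; ring.
  have D3 : (q * e)^-1 `^ q^-1 = q^-1 `^ q^-1 * e^-1 `^ q^-1.
    by rewrite invfM powRM// ltW.
  rewrite ek D3 {1}D1 D2; move: nf0; set X := d^-1 `^ _ => X0.
  by rewrite -[RHS](mulfK (lt0r_neq0 X0)); ring.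
rewrite ler_wpM2r ?invr_ge0 ?powR_ge0//.
apply: ler_pM; rewrite ?(ltW a0) ?(ltW b0)//.
  by apply: le_powR_self => //; rewrite /t; lra.
by apply: le_powR_self => //; rewrite qE; lra.
Qed.

(** * The upper bound for [Kconst], and the passage from [e] to [p - pminus a] *)

Lemma Kconst_le {R : realType} (a b l k e p : R) :
  k = a + b + l -> 0 < a -> 0 < b -> 0 < l -> k < 1 -> 0 < e -> e <= l ->
  p^-1 = 1 - a - e ->
  (Kconst a b l p <= ((2 * (k + k * l / (k - l)) / e) `^ k)%:E)%E.
Proof.
move=> kE a0 b0 l0 k1 e0 el pE.
have p0 : 0 < p by rewrite -invr_gt0 pE; lra.
have qE : (qexp a b l p)^-1 = b + l - e by rewrite /qexp invrK pE; ring.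
have q0 : 0 < qexp a b l p by rewrite -invr_gt0 qE; lra.
have k0 : 0 < k by lra.
have k01 : 0 < k < 1 by rewrite k0.
have lk : l < k by lra.
have kl0 : 0 < k - l by rewrite subr_gt0.
apply: ge_ereal_sup => _ [f [fLp fn0] <-].
have h := normLp_Uop_le a b l k e p _ f kE k01 e0 lk p0 pE qE q0 a0 fLp.
have [_ nfin] := fLp.
have nge0 : (0 <= normLp p f)%E by exact: poweR_ge0.
have [n nE] : exists n, normLp p f = n%:E.
  by exists (fine (normLp p f)); rewrite fineK// ge0_fin_numE.
rewrite nE in h fn0 nge0 *.
have n0 : 0 < n by rewrite lt_neqAle eq_sym -eqe fn0 -lee_fin.
apply: le_trans (lee_wpmul2r _ h) _; first by rewrite lee_fin invr_ge0 ltW.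
rewrite [fine _]/= -!EFinM lee_fin mulfK ?gt_eqF//.
have M1 : 2 * ((e / k)^-1 + (1 - l / k)^-1) = 2 * (k / e + k / (k - l)).
  by field; rewrite !gt_eqF.
have kkl : 0 < k / (k - l) by rewrite divr_gt0.
have ke : 0 < k / e by rewrite divr_gt0.
apply: ge0_ler_powR; rewrite ?nnegrE ?(ltW k0)//.
- by rewrite M1 mulr_ge0// addr_ge0// ltW.
- rewrite divr_ge0 ?(ltW e0)// mulr_ge0// addr_ge0 ?(ltW k0)//.
  by rewrite divr_ge0 ?(ltW kl0)// mulr_ge0 ?(ltW k0) ?(ltW l0).
(* The term k/(k-l), bounded in [e], is absorbed into the one of order 1/e by means of 1 <= l/e. *)
rewrite M1 -mulrA ler_wpM2l// mulrDl lerD2l.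
rewrite -[leLHS]mulr1 (_ : k * l / (k - l) / e = k / (k - l) * (l / e));
  last first.
  by field; rewrite !gt_eqF.
by rewrite ler_wpM2l ?(ltW kkl)// ler_pdivlMr// mul1r.
Qed.

Theorem theorem2p1 (R : realType) (a b l : R) :
  0 < a < 1 -> 0 < b < 1 -> 0 < l < 1 -> a + b + l < 1 ->
  exists C3 C4 : R, 0 < C3 /\ 0 < C4 /\
    forall p : R, pminus a < p -> p <= pplus a l ->
      ((C3 / (p - pminus a) `^ (a + b + l))%:E <= Kconst a b l p)%E /\
      (Kconst a b l p <= (C4 / (p - pminus a) `^ (a + b + l))%:E)%E.
Proof.
move=> /andP[a0 a1] /andP[b0 _] /andP[l0 _] k1; set k := a + b + l.
have k0 : 0 < k by rewrite !addr_gt0.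
have al0 : 0 < 1 - a - l by lra.
have a10 : 0 < 1 - a by lra.
have kl0 : 0 < k - l by rewrite /k; lra.
pose C := 2 * (k + k * l / (k - l)).
have C0 : 0 < C by rewrite mulr_gt0// addr_gt0// divr_gt0// mulr_gt0.
have pm0 : 0 < pminus a by rewrite invr_gt0.
have pp0 : 0 < pplus a l by rewrite invr_gt0.
have Cp0 := mulr_gt0 C0 (mulr_gt0 pp0 pm0).
(* Both constants come from p - p_- = e p p_-. The lower bound uses p p_- >= 1, so that e <= p -
   p_-; the upper bound uses p p_- <= p_+ p_-, whence the extra factor in the second witness. *)
exists (a * b), ((C * (pplus a l * pminus a)) `^ k); split;
  first exact: mulr_gt0.
split; first by rewrite powR_gt0.
move=> p pmp ppp.
have p0 : 0 < p by exact: lt_trans pmp.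
pose e := 1 - a - p^-1.
have pE : p^-1 = 1 - a - e by rewrite /e; ring.
have pm0' : 0 < p - pminus a by rewrite subr_gt0.
have eE : p - pminus a = e * (p * pminus a).
  by rewrite /e /pminus; field; rewrite !gt_eqF.
have e0 : 0 < e by move: pm0'; rewrite eE pmulr_lgt0// mulr_gt0.
(* This is the condition p <= p_+ rewritten, with equality at p = p_+. *)
have el : e <= l.
  have : 1 - a - l <= p^-1 by rewrite -[leLHS]invrK lef_pV2 ?posrE.
  by rewrite /e; lra.
have pm1 : 1 <= pminus a by rewrite invf_ge1//; lra.
have pmp1 : 1 <= p * pminus a.
  by rewrite -[leLHS]mulr1 ler_pM// (le_trans pm1)// ltW.
split.
- apply: le_trans (Kconst_ge a b l k e p erefl a0 b0 l0 k1 e0 el pE).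
  rewrite lee_fin ler_wpM2l ?mulr_ge0 ?(ltW a0) ?(ltW b0)//.
  rewrite lef_pV2 ?posrE ?powR_gt0// ge0_ler_powR ?nnegrE ?(ltW k0) ?(ltW e0)
    ?(ltW pm0')//.
  by rewrite eE ler_peMr// ltW.
- apply: le_trans (Kconst_le a b l k e p erefl a0 b0 l0 k1 e0 el pE) _.
  have -> : (C * (pplus a l * pminus a)) `^ k / (p - pminus a) `^ k =
      (C * (pplus a l * pminus a) / (p - pminus a)) `^ k.
    rewrite [RHS]powRM ?invr_ge0 ?(ltW pm0') ?(ltW Cp0)//.
    by rewrite -[in RHS](powR_inv1 (ltW pm0')) -powRrM mulN1r powRN.
  rewrite lee_fin -/C; apply: ge0_ler_powR; rewrite ?nnegrE ?(ltW k0)//.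
  + by rewrite divr_ge0 ?(ltW C0) ?(ltW e0).
  + by rewrite divr_ge0 ?(ltW pm0') ?(ltW Cp0).
  rewrite -mulrA ler_wpM2l ?(ltW C0)// ler_pdivlMr// eE mulrA mulVf
    ?gt_eqF// mul1r.
  by rewrite ler_wpM2r ?(ltW pm0).
Qed.
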